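(* Let $\Omega=(0,\infty)$, $\lambda=0$ and $1<p\le3$, and let $\varphi\in\mathcal{C}(\overline\Omega)$ be non-negative. Then the problem $$\begin{cases}\partial_t u=\partial_x^2u-u\,\partial_xu+u^p & \text{in }\overline\Omega\times(0,\infty),\\ \partial_\nu u=0 & \text{on }\partial\Omega\times(0,\infty),\\ u(\cdot,0)=\varphi & \text{in }\overline\Omega\end{cases}$$ admits no global positive solution $u$ satisfying the growth condition: for all $a>0$ and all $t>0$, $$\lim_{|x|\to\infty}u(x,t)e^{-a|x|}=0\quad\text{and}\quad\lim_{|x|\to\infty}|\partial_xu(x,t)|e^{-a|x|}=0 .$$
   Context: $\partial_\nu$ is the outward normal derivative, so $\partial_\nu u(0,t)=-\partial_xu(0,t)$. A global solution is a function $u\in\mathcal{C}(\overline\Omega\times[0,\infty))\cap\mathcal{C}^{2,1}(\overline\Omega\times(0,\infty))$ satisfying the equations in the classical sense. Positive means $u>0$ in $\Omega\times(0,\infty)$. *)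

(* Defs.v *)
From Stdlib Require Import Reals.
From Coquelicot Require Import Coquelicot.
Open Scope R_scope.

Definition Omega (x : R) : Prop := 0 < x.
Definition Omega_bar (x : R) : Prop := 0 <= x.
Definition Omega_boundary (x : R) : Prop := x = 0.

(* Stdlib's [ln] is 0 at 0, so [Rpower 0 p = 1]; a solution may a priori vanish
   at the boundary point, where u^p has to be 0. *)
Definition pow_nonneg (x p : R) : R :=
  if Rlt_dec 0 x then Rpower x p else 0.

(* Derivative at [x] relative to [D]: Coquelicot's [is_derive] with [locally x]
   replaced by its trace on [D].  It is the usual derivative at interior points
   of [D] and the one-sided one at an endpoint of an interval. *)
Definition is_derive_within (D : R -> Prop) (f : R -> R) (x l : R) : Prop :=
  filterdiff f (within D (locally x)) (fun y => scal y l).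

Definition continuous_on_prod (A B : R -> Prop) (f : R -> R -> R) : Prop :=
  continuous_on (fun z : R * R => A (fst z) /\ B (snd z))
                (fun z : R * R => f (fst z) (snd z)).

(* u is of class C^{2,1} (C^2 in x, C^1 in t) on Omega_bar x (0,oo), with
   u_t = ut, u_x = ux and u_xx = uxx there; these three functions are uniquely
   determined by u on that set, and irrelevant elsewhere. *)
Record class_C21 (u ut ux uxx : R -> R -> R) : Prop := {
  C21_dt : forall x t, Omega_bar x -> 0 < t ->
    is_derive (fun s => u x s) t (ut x t);
  C21_dx : forall x t, Omega_bar x -> 0 < t ->
    is_derive_within Omega_bar (fun y => u y t) x (ux x t);
  C21_dxx : forall x t, Omega_bar x -> 0 < t ->
    is_derive_within Omega_bar (fun y => ux y t) x (uxx x t);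
  C21_cont : continuous_on_prod Omega_bar (fun t => 0 < t) u;
  C21_cont_dt : continuous_on_prod Omega_bar (fun t => 0 < t) ut;
  C21_cont_dx : continuous_on_prod Omega_bar (fun t => 0 < t) ux;
  C21_cont_dxx : continuous_on_prod Omega_bar (fun t => 0 < t) uxx
}.

(* The outward unit normal to Omega at 0 is -1. *)
Definition normal_derivative (ux : R -> R -> R) (x t : R) : R := - ux x t.

Record global_solution (p : R) (phi : R -> R) (u ut ux uxx : R -> R -> R)
  : Prop := {
  sol_cont : continuous_on_prod Omega_bar (fun t => 0 <= t) u;
  sol_C21 : class_C21 u ut ux uxx;
  sol_pde : forall x t, Omega_bar x -> 0 < t ->
    ut x t = uxx x t - u x t * ux x t + pow_nonneg (u x t) p;
  sol_neumann : forall x t, Omega_boundary x -> 0 < t ->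
    normal_derivative ux x t = 0;
  sol_init : forall x, Omega_bar x -> u x 0 = phi x
}.

Definition positive_solution (u : R -> R -> R) : Prop :=
  forall x t, Omega x -> 0 < t -> 0 < u x t.

(* In Omega, |x| -> oo means x -> +oo. *)
Definition growth_condition (u ux : R -> R -> R) : Prop :=
  forall a t, 0 < a -> 0 < t ->
    is_lim (fun x => u x t * exp (- a * Rabs x)) p_infty 0 /\
    is_lim (fun x => Rabs (ux x t) * exp (- a * Rabs x)) p_infty 0.

(* Main.v *)
(* For decreasing [z] the drift term helps: [- u z_x >= 0].  Hence a decreasing
   subsolution of [z_t = z_xx + z^p] lying below [u] at some time stays below [u],
   by the minimum principle on compact rectangles (beyond which [z] is negligible
   and [u >= 0], so no growth of [u] has to be controlled).  Writing [q = p - 1],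
   the Gaussian
     [z = t^(-1/2) E^(-1/q) exp (- B x^2)],  [E = al - (q / e) ln t],
     [B = 1 / (4 t) + K / 2],  [K = 1 / (e t E)],
   is such a subsolution for [t >= 1] when [q <= 2], and it blows up when [E]
   vanishes.  At [t = 1] it is a small multiple of a Gaussian narrower than
   [exp (- x^2 / 4)], and [u] dominates such a function after some time: a barrier
   gives [u > 0] at the boundary, and [exp (- x^2 / (t - 1))] gives the tail. *)
Require Import Defs.
From Stdlib Require Import Reals Lra List Classical ClassicalChoice.
From Coquelicot Require Import Coquelicot.
Open Scope R_scope.

(** * One-sided derivatives and conditions at a minimum *)

(** A common notion for interior points and for the endpoint 0, where [u] is differentiable only
    from the right. *)
Definition right_derive (f : R -> R) (x l : R) : Prop :=
  forall eps, 0 < eps -> exists delta, 0 < delta /\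
    forall h, 0 < h < delta -> Rabs (f (x + h) - f x - h * l) <= eps * h.

Lemma right_derive_minus (f g : R -> R) (x l m : R) :
  right_derive f x l -> right_derive g x m ->
  right_derive (fun y => f y - g y) x (l - m).
Proof.
  intros Hf Hg eps Heps.
  destruct (Hf (eps / 2)) as [d1 [Hd1 H1]]; [lra|].
  destruct (Hg (eps / 2)) as [d2 [Hd2 H2]]; [lra|].
  exists (Rmin d1 d2); split; [apply Rmin_glb_lt; assumption|].
  intros h [Hh0 Hh].
  specialize (H1 h (conj Hh0 (Rlt_le_trans _ _ _ Hh (Rmin_l _ _)))).
  specialize (H2 h (conj Hh0 (Rlt_le_trans _ _ _ Hh (Rmin_r _ _)))).
  apply Rabs_le_between in H1; apply Rabs_le_between in H2.
  apply Rabs_le_between; lra.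
Qed.

Lemma is_derive_within_bound (D : R -> Prop) (f : R -> R) (x l : R) :
  D x -> is_derive_within D f x l ->
  forall eps, 0 < eps -> exists delta, 0 < delta /\
    forall y, Rabs (y - x) < delta -> D y ->
      Rabs (f y - f x - (y - x) * l) <= eps * Rabs (y - x).
Proof.
  intros Dx [_ Hd] eps Heps.
  assert (Hlim : is_filter_lim (within D (locally x)) x).
  { intros P [d Hd']; exists d; intros y Hy _; apply Hd', Hy. }
  destruct (Hd x Hlim (mkposreal eps Heps)) as [d Hd'].
  exists d; split; [apply cond_pos|].
  intros y Hy Dy; exact (Hd' y Hy Dy).
Qed.

Lemma is_derive_within_right (f : R -> R) (x l : R) :
  0 <= x -> is_derive_within Omega_bar f x l -> right_derive f x l.
Proof.
  intros Hx Hd eps Heps.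
  destruct (is_derive_within_bound _ _ _ _ Hx Hd eps Heps) as [d [Hd0 H]].
  exists d; split; [exact Hd0|].
  intros h Hh.
  assert (E : x + h - x = h) by ring.
  specialize (H (x + h)); rewrite E, (Rabs_pos_eq h) in H by lra.
  apply H; [lra | unfold Omega_bar; lra].
Qed.

Lemma is_derive_within_interior (f : R -> R) (x l : R) :
  0 < x -> is_derive_within Omega_bar f x l -> is_derive f x l.
Proof.
  intros Hx [Hlin Hd]; split; [exact Hlin|].
  intros y Hy eps.
  assert (Hlim : is_filter_lim (within Omega_bar (locally x)) y).
  { intros P HP; apply filter_le_within, Hy, HP. }
  specialize (Hd y Hlim eps).
  assert (Hpos : locally x Omega_bar).
  { exists (mkposreal x Hx); intros z Hz.
    apply Rabs_lt_between' in Hz; simpl in Hz; unfold Omega_bar; lra. }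
  unfold within in Hd.
  generalize (filter_and (F := locally x) _ _ Hd Hpos); apply filter_imp.
  intros z [H1 H2]; exact (H1 H2).
Qed.

Lemma is_derive_right (f : R -> R) (x l : R) :
  is_derive f x l -> right_derive f x l.
Proof.
  intros [_ Hd] eps Heps.
  destruct (Hd x (fun P HP => HP) (mkposreal eps Heps)) as [d Hd'].
  exists d; split; [apply cond_pos|].
  intros h Hh.
  specialize (Hd' (x + h)).
  unfold ball, minus, plus, opp, norm, scal in Hd'; simpl in Hd'.
  unfold AbsRing_ball, minus, plus, opp, abs in Hd'; simpl in Hd'.
  unfold mult in Hd'; simpl in Hd'.
  replace (x + h + - x) with h in Hd' by ring.
  rewrite (Rabs_pos_eq h) in Hd' by lra.
  apply Hd'; lra.
Qed.

(** Reflection turns left neighbourhoods into right ones, so one-sided facts are proved only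
    once. *)
Lemma is_derive_left (f : R -> R) (x l : R) :
  is_derive f x l -> right_derive (fun y => f (- y)) (- x) (- l).
Proof.
  intros H; apply is_derive_right.
  replace (- l) with (scal (-1) l) by (unfold scal; simpl; unfold mult; simpl; ring).
  apply (is_derive_comp f (fun y => - y)).
  - rewrite Ropp_involutive; exact H.
  - auto_derive; [exact I | ring].
Qed.

Lemma right_min_derive (f : R -> R) (x l r : R) :
  right_derive f x l -> 0 < r -> (forall h, 0 < h < r -> f x <= f (x + h)) ->
  0 <= l.
Proof.
  intros Hd Hr Hmin; apply Rnot_lt_le; intros Hl.
  destruct (Hd (- l / 2)) as [d [Hd0 H]]; [lra|].
  set (h := Rmin d r / 2).
  assert (Hm := Rmin_glb_lt _ _ _ Hd0 Hr).
  assert (H1 := Rmin_l d r); assert (H2 := Rmin_r d r).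
  assert (Hh : 0 < h) by (unfold h; lra).
  specialize (H h ltac:(unfold h in *; lra)).
  specialize (Hmin h ltac:(unfold h in *; lra)).
  apply Rabs_le_between in H; nra.
Qed.

Lemma left_min_derive (f : R -> R) (x l r : R) :
  is_derive f x l -> 0 < r -> (forall h, 0 < h < r -> f x <= f (x - h)) ->
  l <= 0.
Proof.
  intros Hd Hr Hmin.
  enough (0 <= - l) by lra.
  apply (right_min_derive (fun y => f (- y)) (- x) (- l) r); auto using is_derive_left.
  intros h Hh; rewrite Ropp_involutive.
  replace (- (- x + h)) with (x - h) by ring; auto.
Qed.

(** A second-order condition that also applies at an endpoint. If [l < 0], then [g < 0] just to the
    right of [x], so [f] decreases strictly there, against minimality at [x]. *)
Lemma right_min_derive2 (f g : R -> R) (x l r : R) :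
  right_derive f x 0 -> g x = 0 -> right_derive g x l -> 0 < r ->
  (forall h, 0 < h < r -> is_derive f (x + h) (g (x + h))) ->
  (forall h, 0 < h < r -> f x <= f (x + h)) ->
  0 <= l.
Proof.
  intros Hf Hg0 Hg Hr Hder Hmin; apply Rnot_lt_le; intros Hl.
  destruct (Hg (- l / 2)) as [d [Hd0 H]]; [lra|].
  assert (Hm := Rmin_glb_lt _ _ _ Hd0 Hr).
  assert (H1 := Rmin_l d r); assert (H2 := Rmin_r d r).
  assert (Hneg : forall h, 0 < h < Rmin d r -> g (x + h) < 0).
  { intros h Hh; specialize (H h ltac:(lra)); rewrite Hg0 in H.
    apply Rabs_le_between in H; nra. }
  assert (Hdec : forall h k, 0 < h -> h < k -> k < Rmin d r -> f (x + k) < f (x + h)).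
  { intros h k Hh Hhk Hk.
    destruct (MVT_gen f (x + h) (x + k) g) as [c [Hc Heq]].
    - intros y Hy; rewrite Rmin_left, Rmax_right in Hy by lra.
      replace y with (x + (y - x)) by ring; apply Hder; lra.
    - intros y Hy; rewrite Rmin_left, Rmax_right in Hy by lra.
      apply continuity_pt_filterlim, (ex_derive_continuous (V := R_NormedModule)).
      exists (g y); replace y with (x + (y - x)) by ring; apply Hder; lra.
    - rewrite Rmin_left, Rmax_right in Hc by lra.
      specialize (Hneg (c - x) ltac:(lra)).
      replace (x + (c - x)) with c in Hneg by ring; nra. }
  set (k := Rmin d r / 2).
  assert (Hstep := Hdec (k / 2) k ltac:(unfold k; lra) ltac:(unfold k; lra) ltac:(unfold k; lra)).
  assert (Hfk := Hmin k ltac:(unfold k; lra)).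
  (* The mean value theorem is used only away from [x]. The drop [gap] is fixed, while the zero
     slope at [x] makes [f (x + h) - f x] smaller than [gap] for small [h]. *)
  set (gap := f (x + k / 2) - f (x + k)).
  destruct (Hf 1) as [e [He0 He]]; [lra|].
  set (h := Rmin (Rmin (k / 2) e) gap / 2).
  assert (0 < h < k / 2 /\ h < e /\ h < gap).
  { assert (A : 0 < Rmin (Rmin (k / 2) e) gap).
    { repeat apply Rmin_glb_lt; unfold k, gap; lra. }
    assert (B1 := Rmin_l (Rmin (k / 2) e) gap); assert (B2 := Rmin_r (Rmin (k / 2) e) gap).
    assert (B3 := Rmin_l (k / 2) e); assert (B4 := Rmin_r (k / 2) e).
    unfold h; lra. }
  specialize (He h ltac:(lra)); apply Rabs_le_between in He.
  assert (Hlast := Hdec h (k / 2) ltac:(lra) ltac:(lra) ltac:(unfold k; lra)).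
  unfold gap in *; lra.
Qed.

(** * Compactness: minima on rectangles *)

Lemma exists_argmin_list (A : Type) (F : A -> R) (l : list A) :
  l <> nil -> exists a, In a l /\ forall b, In b l -> F a <= F b.
Proof.
  induction l as [|a l IH]; [congruence|intros _].
  destruct l as [|a' l].
  - exists a; split; [now left|]; intros b [<-|[]]; lra.
  - destruct IH as [m [Hm Hmin]]; [congruence|].
    destruct (Rle_lt_dec (F a) (F m)) as [H|H].
    + exists a; split; [now left|]; intros b [<-|Hb]; [lra|].
      specialize (Hmin b Hb); lra.
    + exists m; split; [now right|]; intros b [<-|Hb]; [lra|auto].
Qed.

(** Were no minimum attained, each point would have a neighbourhood on which [f] exceeds its value
    at some chosen point of the rectangle. Finitely many neighbourhoods cover the rectangle, and the
    lowest of the chosen values is then undercut by another one. *)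
Lemma rectangle_min (f : R -> R -> R) (a b c d : R) :
  a <= b -> c <= d ->
  continuous_on_prod (fun x => a <= x <= b) (fun t => c <= t <= d) f ->
  exists x t, (a <= x <= b /\ c <= t <= d) /\
    forall y s, a <= y <= b -> c <= s <= d -> f x t <= f y s.
Proof.
  intros Hab Hcd Hcont.
  apply NNPP; intros Hno.
  set (Q := fun z : R * (R * unit) =>
    a <= fst z <= b /\ c <= fst (snd z) <= d).
  assert (Hstep : forall z : R * (R * unit), exists w : posreal * (R * R),
    Q z ->
    (a <= fst (snd w) <= b /\ c <= snd (snd w) <= d) /\
    forall y s, a <= y <= b -> c <= s <= d ->
      Rabs (y - fst z) < fst w -> Rabs (s - fst (snd z)) < fst w ->
      f (fst (snd w)) (snd (snd w)) < f y s).
  { intros z; destruct (classic (Q z)) as [[Hx Ht]|Hz];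
      [|exists (mkposreal 1 Rlt_0_1, (0, 0)); tauto].
    destruct z as [x [t []]]; simpl in Hx, Ht.
    destruct (classic (exists y s, (a <= y <= b /\ c <= s <= d) /\ f y s < f x t))
      as [[y [s [Hys Hlt]]]|Hn].
    - destruct (Hcont (x, t) (conj Hx Ht)
        (fun r => f y s < r)) as [e He].
      { simpl; apply (open_gt (f y s)); exact Hlt. }
      exists (e, (y, s)); intros _; simpl; split; [exact Hys|].
      intros y' s' Hy' Hs' H1 H2.
      apply (He (y', s')); [split; assumption | split; assumption].
    - exfalso; apply Hno; exists x, t; split; [split; assumption|].
      intros y s Hy Hs; apply Rnot_lt_le; intros Hlt; apply Hn.
      exists y, s; auto. }
  apply choice in Hstep as [W HW].
  apply (compactness_list 2 (a, (c, tt)) (b, (d, tt)) (fun z => fst (W z))).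
  intros [l Hl].
  (* The list may contain centres outside the rectangle, about which [W] promises nothing; they are
     discarded. *)
  set (l' := filter (fun z : R * (R * unit) =>
     if Rle_dec a (fst z) then if Rle_dec (fst z) b then
     if Rle_dec c (fst (snd z)) then if Rle_dec (fst (snd z)) d then true
     else false else false else false else false) l).
  assert (Hl' : forall z, In z l' <-> In z l /\ Q z).
  { intros z; unfold l', Q; rewrite filter_In.
    repeat destruct Rle_dec; intuition (try lra; try discriminate). }
  assert (Hcov : forall y s, a <= y <= b -> c <= s <= d -> exists z, In z l' /\
     f (fst (snd (W z))) (snd (snd (W z))) < f y s).
  { intros y s Hy Hs.
    destruct (Hl (y, (s, tt))) as [[x [t []]] [Hin [Hb Hclose]]]; [simpl; auto|].
    simpl in Hb, Hclose.
    assert (HQ : Q (x, (t, tt))) by (split; simpl; tauto).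
    exists (x, (t, tt)); split; [apply Hl'; auto|].
    apply (HW _ HQ); simpl; tauto. }
  destruct (exists_argmin_list _ (fun z => f (fst (snd (W z))) (snd (snd (W z)))) l')
    as [m [Hm Hmin]].
  { intros E; destruct (Hcov a c) as [z [Hz _]]; [lra|lra|].
    rewrite E in Hz; exact Hz. }
  apply Hl' in Hm as [_ HQ].
  destruct (HW m HQ) as [[H1 H2] _].
  destruct (Hcov _ _ H1 H2) as [z [Hz Hlt]].
  specialize (Hmin z Hz); lra.
Qed.

(** * The reaction term *)

Lemma pow_nonneg_pos (x p : R) : 0 < x -> pow_nonneg x p = Rpower x p.
Proof. intros H; unfold pow_nonneg; destruct Rlt_dec; [reflexivity|lra]. Qed.

Lemma pow_nonneg_ge0 (x p : R) : 0 <= pow_nonneg x p.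
Proof.
  unfold pow_nonneg; destruct Rlt_dec; [left; apply exp_pos|lra].
Qed.

(** For [x > 0] this is the mean value theorem. At [x = 0], where [Rpower] is not the power
    function, the factorisation [y^p = y^(p-1) y] replaces it. *)
Lemma pow_nonneg_lipschitz (p x y Z : R) :
  1 < p -> 0 <= x -> x < y -> y <= Z ->
  pow_nonneg y p - pow_nonneg x p <= p * Rpower Z (p - 1) * (y - x).
Proof.
  intros Hp Hx Hxy HyZ.
  assert (Hmono : forall c, 0 < c <= Z -> Rpower c (p - 1) <= Rpower Z (p - 1)).
  { intros c Hc; apply Rle_Rpower_l; lra. }
  rewrite (pow_nonneg_pos y) by lra.
  destruct (Rle_lt_or_eq_dec 0 x Hx) as [Hx0| <-].
  - rewrite pow_nonneg_pos by exact Hx0.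
    destruct (MVT_gen (fun r => Rpower r p) x y (fun r => p * Rpower r (p - 1)))
      as [c [Hc ->]].
    + intros r Hr; rewrite Rmin_left, Rmax_right in Hr by lra.
      apply is_derive_Reals, derivable_pt_lim_power; lra.
    + intros r Hr; rewrite Rmin_left, Rmax_right in Hr by lra.
      apply derivable_continuous_pt; exists (p * Rpower r (p - 1)).
      apply derivable_pt_lim_power; lra.
    + rewrite Rmin_left, Rmax_right in Hc by lra.
      apply Rmult_le_compat_r; [lra|].
      apply Rmult_le_compat_l; [lra|].
      apply Hmono; lra.
  - unfold pow_nonneg; destruct Rlt_dec; [lra|].
    replace (Rpower y p) with (Rpower y (p - 1) * y).
    2:{ rewrite <- (Rpower_1 y) at 2 by lra; rewrite <- Rpower_plus; f_equal; ring. }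
    specialize (Hmono y ltac:(lra)).
    assert (0 < Rpower Z (p - 1)) by apply exp_pos.
    rewrite !Rminus_0_r.
    apply Rmult_le_compat_r; nra.
Qed.

(** * Joint continuity on product sets *)

Lemma continuous_on_prod_subset (A B A' B' : R -> Prop) (f : R -> R -> R) :
  (forall x, A' x -> A x) -> (forall t, B' t -> B t) ->
  continuous_on_prod A B f -> continuous_on_prod A' B' f.
Proof.
  intros HA HB; apply continuous_on_subset.
  intros z [H1 H2]; split; auto.
Qed.

Lemma continuous_on_prod_everywhere (A B : R -> Prop) (f : R -> R -> R) :
  (forall x t, A x -> B t ->
     continuous (fun z : R * R => f (fst z) (snd z)) (x, t)) ->
  continuous_on_prod A B f.
Proof.
  intros H [x t] [Hx Ht].
  refine (filterlim_filter_le_1 _ _ (H x t Hx Ht)); apply filter_le_within.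
Qed.

Lemma continuous_on_prod_minus (A B : R -> Prop) (f g : R -> R -> R) :
  continuous_on_prod A B f -> continuous_on_prod A B g ->
  continuous_on_prod A B (fun x t => f x t - g x t).
Proof.
  intros Hf Hg z Hz.
  refine (filterlim_comp_2 _ _ Rplus (Hf z Hz) _ (filterlim_plus (V := R_NormedModule) _ _)).
  refine (filterlim_comp _ _ _ _ Ropp _ _ _ (Hg z Hz) _).
  apply (filterlim_opp (V := R_NormedModule)).
Qed.

Lemma continuous_on_prod_mult (A B : R -> Prop) (f g : R -> R -> R) :
  continuous_on_prod A B f -> continuous_on_prod A B g ->
  continuous_on_prod A B (fun x t => f x t * g x t).
Proof.
  intros Hf Hg z Hz.
  exact (filterlim_comp_2 _ _ Rmult (Hf z Hz) (Hg z Hz) (filterlim_mult (K := R_AbsRing) _ _)).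
Qed.

Lemma continuous_snd_comp (g : R -> R) (x t : R) :
  continuous g t -> continuous (fun z : R * R => g (snd z)) (x, t).
Proof.
  intros H; apply (continuous_comp (fun z : R * R => snd z) g); [apply continuous_snd | exact H].
Qed.

(** * Comparison with subsolutions *)

(** Only [x = 0] is at issue: a negative value there would persist for small [h > 0] by the
    first-order expansion in [x], against positivity in [Omega]. *)
Lemma positive_solution_nonneg (p : R) (phi : R -> R) (u ut ux uxx : R -> R -> R) :
  global_solution p phi u ut ux uxx -> positive_solution u ->
  forall x t, 0 <= x -> 0 < t -> 0 <= u x t.
Proof.
  intros Hsol Hpos x t Hx Ht.
  destruct (Rle_lt_or_eq_dec 0 x Hx) as [H| <-]; [left; apply Hpos; assumption|].
  apply Rnot_lt_le; intros Hneg.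
  assert (Hd := C21_dx _ _ _ _ (sol_C21 _ _ _ _ _ _ Hsol) 0 t (Rle_refl 0) Ht).
  destruct (is_derive_within_right _ _ _ (Rle_refl 0) Hd 1) as [d [Hd0 H]]; [lra|].
  set (M := Rabs (ux 0 t) + 1).
  assert (HM : 1 <= M) by (unfold M; assert (A := Rabs_pos (ux 0 t)); lra).
  set (h := Rmin d (- u 0 t / M) / 2).
  assert (Hq : 0 < - u 0 t / M) by (apply Rdiv_lt_0_compat; lra).
  assert (Hm := Rmin_glb_lt _ _ _ Hd0 Hq).
  assert (H1 := Rmin_l d (- u 0 t / M)); assert (H2 := Rmin_r d (- u 0 t / M)).
  assert (Hh : 0 < h < d) by (unfold h; lra).
  assert (HhM : h * M < - u 0 t).
  { apply Rlt_le_trans with (- u 0 t / M * M); [|right; field; lra].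
    apply Rmult_lt_compat_r; unfold h; lra. }
  specialize (H h Hh); rewrite Rplus_0_l in H; apply Rabs_le_between in H.
  specialize (Hpos h t (proj1 Hh) Ht).
  assert (A := Rle_abs (ux 0 t)); unfold M in HhM; nra.
Qed.

Lemma exp_monotone (x y : R) : x <= y -> exp x <= exp y.
Proof.
  intros [H| ->]; [left; apply exp_increasing, H | apply Rle_refl].
Qed.

(* At a negative minimum of [exp (- k (t - t0)) (u - z)] the first derivatives in
   [x] of [u] and [z] agree, so it suffices that [z] is a subsolution for the
   linear drift [- u z_x]. *)
Lemma comparison (p : R) (phi : R -> R) (u ut ux uxx z zt zx zxx : R -> R -> R)
  (a X t0 t1 eta Z : R) :
  1 < p -> global_solution p phi u ut ux uxx -> positive_solution u ->
  0 <= a -> a <= X -> 0 < t0 -> t0 <= t1 -> 0 <= eta ->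
  (forall x t, a <= x <= X -> t0 <= t <= t1 ->
     is_derive (fun s => z x s) t (zt x t)) ->
  (forall x t, a <= x <= X -> t0 <= t <= t1 ->
     is_derive (fun y => z y t) x (zx x t)) ->
  (forall x t, a <= x <= X -> t0 <= t <= t1 ->
     is_derive (fun y => zx y t) x (zxx x t)) ->
  continuous_on_prod (fun x => a <= x <= X) (fun t => t0 <= t <= t1) z ->
  (forall x t, a <= x <= X -> t0 <= t <= t1 -> z x t <= Z) ->
  (forall x t, a <= x <= X -> t0 <= t <= t1 ->
     zt x t <= zxx x t - u x t * zx x t + pow_nonneg (z x t) p) ->
  (forall x, a <= x <= X -> z x t0 - eta <= u x t0) ->
  (forall t, t0 <= t <= t1 -> z X t - eta <= u X t) ->
  (forall t, t0 <= t <= t1 -> z a t - eta <= u a t \/ a = 0 /\ 0 <= zx a t) ->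
  forall x t, a <= x <= X -> t0 <= t <= t1 ->
    z x t - eta * exp ((p * Rpower Z (p - 1) + 1) * (t - t0)) <= u x t.
Proof.
  intros Hp Hsol Hpos Ha HaX Ht0 Ht01 Heta Hzt Hzx Hzxx Hzc HZ Hsub Hini HX Hbd.
  (* The Lipschitz constant of the power on [[0, Z]], plus 1; the extra 1 yields the final
     contradiction. *)
  set (k := p * Rpower Z (p - 1) + 1).
  assert (Hk : 0 < k).
  { unfold k; assert (0 < Rpower Z (p - 1)) by apply exp_pos; nra. }
  set (D := fun x t => (u x t - z x t) * exp (- k * (t - t0))).
  assert (HDc : continuous_on_prod (fun x => a <= x <= X) (fun t => t0 <= t <= t1) D).
  { apply continuous_on_prod_mult; [apply continuous_on_prod_minus|].
    - generalize (C21_cont _ _ _ _ (sol_C21 _ _ _ _ _ _ Hsol)).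
      apply continuous_on_prod_subset; unfold Omega_bar; intros; lra.
    - exact Hzc.
    - apply continuous_on_prod_everywhere; intros x t _ _.
      apply (continuous_snd_comp (fun t => exp (- k * (t - t0)))).
      apply (ex_derive_continuous (V := R_NormedModule)); auto_derive; exact I. }
  destruct (rectangle_min D a X t0 t1 HaX Ht01 HDc) as [x [t [[Hx Ht] Hmin]]].
  assert (HD : - eta <= D x t).
  2:{ intros y s Hy Hs; specialize (Hmin y s Hy Hs).
      assert (E : u y s - z y s = D y s * exp (k * (s - t0))).
      { unfold D; rewrite Rmult_assoc, <- exp_plus.
        replace (- k * (s - t0) + k * (s - t0)) with 0 by ring; rewrite exp_0; ring. }
      assert (A := exp_pos (k * (s - t0))); nra. }
  apply Rnot_lt_le; intros Hlt.
  assert (Hexp1 : exp (- k * (t - t0)) <= 1).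
  { rewrite <- exp_0; apply exp_monotone; nra. }
  assert (Hexp0 := exp_pos (- k * (t - t0))).
  assert (Hu : u x t - z x t < - eta) by (unfold D in Hlt; nra).
  (* A value below [- eta] excludes the initial time and the right edge. *)
  assert (Ht' : t0 < t).
  { destruct (Rle_lt_or_eq_dec t0 t (proj1 Ht)) as [H| <-]; [exact H|].
    specialize (Hini x Hx); lra. }
  assert (HxX : x < X).
  { destruct (Rle_lt_or_eq_dec x X (proj2 Hx)) as [H| ->]; [exact H|].
    specialize (HX t Ht); lra. }
  assert (Htp : 0 < t) by lra.
  assert (Hxp : Omega_bar x) by (unfold Omega_bar; lra).
  assert (Hxmin : forall y, a <= y <= X -> u x t - z x t <= u y t - z y t).
  { intros y Hy; specialize (Hmin y t Hy Ht); unfold D in Hmin.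
    apply Rmult_le_reg_r in Hmin; assumption. }
  assert (HC := sol_C21 _ _ _ _ _ _ Hsol).
  assert (Hux := C21_dx _ _ _ _ HC x t Hxp Htp).
  assert (Huxx := C21_dxx _ _ _ _ HC x t Hxp Htp).
  assert (Hdr : right_derive (fun y => u y t - z y t) x (ux x t - zx x t)).
  { apply right_derive_minus; [apply is_derive_within_right; assumption|].
    apply is_derive_right, Hzx; assumption. }
  assert (Hddr : right_derive (fun y => ux y t - zx y t) x (uxx x t - zxx x t)).
  { apply right_derive_minus; [apply is_derive_within_right; assumption|].
    apply is_derive_right, Hzxx; assumption. }
  assert (Hge : 0 <= ux x t - zx x t).
  { apply (right_min_derive _ _ _ (X - x) Hdr); [lra|].
    intros h Hh; apply Hxmin; lra. }
  (* On the left edge only the Neumann alternative survives: there [ux = 0 <= zx], and minimality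
     from the right gives the reverse inequality. *)
  assert (Hgrad : ux x t - zx x t = 0).
  { destruct (Rle_lt_or_eq_dec a x (proj1 Hx)) as [H| <-].
    - apply Rle_antisym; [|exact Hge].
      apply (left_min_derive (fun y => u y t - z y t) x _ (x - a)); [|lra|].
      + apply (is_derive_minus (fun y => u y t) (fun y => z y t)); [|apply Hzx; assumption].
        apply is_derive_within_interior; [lra|assumption].
      + intros h Hh; apply Hxmin; lra.
    - destruct (Hbd t Ht) as [H|[-> H]]; [lra|].
      assert (N := sol_neumann _ _ _ _ _ _ Hsol 0 t eq_refl Htp).
      unfold normal_derivative in N; lra. }
  assert (Hlap : 0 <= uxx x t - zxx x t).
  { apply (right_min_derive2 (fun y => u y t - z y t) (fun y => ux y t - zx y t) x _ (X - x));
      [rewrite <- Hgrad; exact Hdr | exact Hgrad | exact Hddr | lra | |].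
    - intros h Hh.
      apply (is_derive_minus (fun y => u y t) (fun y => z y t)); [|apply Hzx; lra].
      apply is_derive_within_interior; [lra|].
      apply (C21_dx _ _ _ _ HC); unfold Omega_bar; lra.
    - intros h Hh; apply Hxmin; lra. }
  (* The minimum may lie at the final time [t1], so it is compared with earlier times only. *)
  assert (Htime : ut x t - zt x t <= k * (u x t - z x t)).
  { assert (HDt : is_derive (fun s => D x s) t
      ((ut x t - zt x t - k * (u x t - z x t)) * exp (- k * (t - t0)))).
    { assert (Hexpd : is_derive (fun s => exp (- k * (s - t0))) t
        (- k * exp (- k * (t - t0)))) by (auto_derive; [exact I | unfold Rminus; simpl; ring]).
      unfold D.
      replace ((ut x t - zt x t - k * (u x t - z x t)) * exp (- k * (t - t0)))
        with ((ut x t - zt x t) * exp (- k * (t - t0))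
              + (u x t - z x t) * (- k * exp (- k * (t - t0)))) by ring.
      apply (is_derive_mult (fun s => u x s - z x s) (fun s => exp (- k * (s - t0)))).
      - apply (is_derive_minus (fun s => u x s) (fun s => z x s));
          [apply (C21_dt _ _ _ _ HC); assumption | apply Hzt; assumption].
      - exact Hexpd.
      - intros; apply Rmult_comm. }
    apply (left_min_derive _ _ _ (t - t0)) in HDt; [|lra|].
    - apply Rnot_lt_le; intros H.
      assert (0 < (ut x t - zt x t - k * (u x t - z x t)) * exp (- k * (t - t0)));
        [apply Rmult_lt_0_compat; lra | lra].
    - intros h Hh; apply Hmin; lra. }
  assert (Hu0 := positive_solution_nonneg _ _ _ _ _ _ Hsol Hpos x t Hxp Htp).
  assert (Hpde := sol_pde _ _ _ _ _ _ Hsol x t Hxp Htp).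
  assert (Hs := Hsub x t Hx Ht).
  assert (Hlip := pow_nonneg_lipschitz p (u x t) (z x t) Z Hp Hu0 ltac:(lra) (HZ x t Hx Ht)).
  (* With [d = u - z < 0], the equation and the subsolution inequality give [d_t >= (k - 1) d],
     while [Htime] says [d_t <= k d]; these are incompatible. *)
  replace (zx x t) with (ux x t) in Hs by lra.
  unfold k in Htime; lra.
Qed.

(** Here [z = exp (g - B x^2)]. Since [- u z_x = 2 B x u z >= 0], dividing the subsolution
    inequality by [z] leaves a condition free of [u]. At [a = 0] the slope of [z] vanishes, which
    meets the Neumann alternative. *)
Lemma gaussian_comparison (p : R) (phi : R -> R) (u ut ux uxx : R -> R -> R)
  (g dg B dB : R -> R) (a X t0 t1 eta Z : R) :
  1 < p -> global_solution p phi u ut ux uxx -> positive_solution u ->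
  0 <= a -> a <= X -> 0 < t0 -> t0 <= t1 -> 0 <= eta ->
  (forall t, t0 <= t <= t1 -> is_derive g t (dg t)) ->
  (forall t, t0 <= t <= t1 -> is_derive B t (dB t)) ->
  (forall t, t0 <= t <= t1 -> 0 <= B t) ->
  (forall t, t0 <= t <= t1 -> exp (g t) <= Z) ->
  (forall x t, a <= x -> t0 <= t <= t1 ->
     dg t - dB t * x ^ 2 <=
     4 * (B t) ^ 2 * x ^ 2 - 2 * B t + exp ((p - 1) * (g t - B t * x ^ 2))) ->
  (forall x, a <= x <= X -> exp (g t0 - B t0 * x ^ 2) - eta <= u x t0) ->
  (forall t, t0 <= t <= t1 -> exp (g t - B t * X ^ 2) - eta <= u X t) ->
  (forall t, t0 <= t <= t1 -> exp (g t - B t * a ^ 2) - eta <= u a t \/ a = 0) ->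
  forall x t, a <= x <= X -> t0 <= t <= t1 ->
    exp (g t - B t * x ^ 2)
      - eta * exp ((p * Rpower Z (p - 1) + 1) * (t - t0)) <= u x t.
Proof.
  intros Hp Hsol Hpos Ha HaX Ht0 Ht01 Heta Hg HB HB0 HZ Hsub Hini HX Hbd.
  apply (comparison p phi u ut ux uxx (fun x t => exp (g t - B t * x ^ 2))
    (fun x t => (dg t - dB t * x ^ 2) * exp (g t - B t * x ^ 2))
    (fun x t => - 2 * B t * x * exp (g t - B t * x ^ 2))
    (fun x t => (4 * (B t) ^ 2 * x ^ 2 - 2 * B t) * exp (g t - B t * x ^ 2)));
    auto.
  - intros x t Hx Ht; specialize (Hg t Ht); specialize (HB t Ht).
    auto_derive.
    + repeat split; [exists (dg t) | exists (dB t)]; assumption.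
    + rewrite (is_derive_unique (fun x : R => g x) _ _ Hg),
        (is_derive_unique (fun x : R => B x) _ _ HB).
      unfold Rminus; simpl; ring.
  - intros x t Hx Ht; auto_derive; [exact I|unfold Rminus; simpl; ring].
  - intros x t Hx Ht; auto_derive; [exact I|unfold Rminus; simpl; ring].
  - apply continuous_on_prod_everywhere; intros x t Hx Ht.
    apply (continuous_comp (fun z : R * R => g (snd z) - B (snd z) * (fst z) ^ 2) exp).
    + apply (continuous_minus (V := R_NormedModule)).
      * apply continuous_snd_comp, (ex_derive_continuous (V := R_NormedModule)).
        exists (dg t); auto.
      * apply (continuous_mult (K := R_AbsRing)).
        -- apply continuous_snd_comp, (ex_derive_continuous (V := R_NormedModule)).
           exists (dB t); auto.
        -- apply (continuous_comp (fun z : R * R => fst z) (fun x => x ^ 2)).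
           ++ apply continuous_fst.
           ++ apply (ex_derive_continuous (V := R_NormedModule)); auto_derive; exact I.
    + apply (ex_derive_continuous (V := R_NormedModule)); auto_derive; exact I.
  - intros x t Hx Ht; apply Rle_trans with (exp (g t)); [|auto].
    apply exp_monotone; specialize (HB0 t Ht); assert (0 <= x ^ 2) by apply pow2_ge_0; nra.
  - intros x t Hx Ht.
    assert (He := exp_pos (g t - B t * x ^ 2)).
    rewrite pow_nonneg_pos by exact He.
    unfold Rpower; rewrite ln_exp.
    replace (p * (g t - B t * x ^ 2))
      with ((p - 1) * (g t - B t * x ^ 2) + (g t - B t * x ^ 2)) by ring.
    rewrite exp_plus.
    assert (Hdrift : 0 <= u x t * (2 * B t * x * exp (g t - B t * x ^ 2))).
    { apply Rmult_le_pos.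
      - apply (positive_solution_nonneg _ _ _ _ _ _ Hsol Hpos); lra.
      - repeat apply Rmult_le_pos; try lra; apply HB0; assumption. }
    assert (Hs := Rmult_le_compat_r _ _ _ (Rlt_le _ _ He) (Hsub x t (proj1 Hx) Ht)).
    lra.
  - intros t Ht; destruct (Hbd t Ht) as [H| ->]; [left; exact H|right; split; [ring|lra]].
Qed.

(** * Gaussian tails and vanishing tolerance *)

(** Used chiefly to place the far edge of a rectangle, where the Gaussian is within the tolerance
    and [u >= 0] suffices. It rests on [exp (b X^2) >= b X^2 >= b X], valid as [X >= 1]. *)
Lemma gaussian_tail (b Z eta x0 : R) :
  0 < b -> 0 < eta -> exists X, x0 <= X /\ Z * exp (- b * X ^ 2) <= eta.
Proof.
  intros Hb Heta.
  set (X := Rmax (Rmax x0 1) (Rabs Z / (b * eta))).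
  assert (H1 : Rmax x0 1 <= X) by apply Rmax_l.
  assert (H2 : Rabs Z / (b * eta) <= X) by apply Rmax_r.
  assert (H3 : x0 <= Rmax x0 1) by apply Rmax_l.
  assert (H4 : 1 <= Rmax x0 1) by apply Rmax_r.
  exists X; split; [lra|].
  assert (Hbe : 0 < b * eta) by (apply Rmult_lt_0_compat; lra).
  assert (HZ : Rabs Z <= X * (b * eta)).
  { replace (Rabs Z) with (Rabs Z / (b * eta) * (b * eta)) by (field; lra).
    apply Rmult_le_compat_r; lra. }
  assert (He := exp_pos (- b * X ^ 2)).
  assert (HX : X <= X ^ 2) by nra.
  assert (Hinv : exp (b * X ^ 2) * exp (- b * X ^ 2) = 1).
  { rewrite <- exp_plus, <- exp_0; f_equal; ring. }
  assert (Hlin : b * X ^ 2 <= exp (b * X ^ 2)).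
  { assert (A := exp_ineq1_le (b * X ^ 2)); lra. }
  apply Rle_trans with (Rabs Z * exp (- b * X ^ 2)).
  { apply Rmult_le_compat_r; [lra|apply Rle_abs]. }
  apply Rle_trans with (eta * (exp (b * X ^ 2) * exp (- b * X ^ 2))); [|rewrite Hinv; lra].
  rewrite <- Rmult_assoc; apply Rmult_le_compat_r; [lra|].
  apply Rle_trans with (X * (b * eta)); [exact HZ|]; nra.
Qed.

(** The far edge depends on [eta] but the amplification factor [C] does not, so the tolerance can be
    sent to 0. *)
Lemma le_of_forall_eps (x y C : R) :
  0 <= C -> (forall eta, 0 < eta -> x - eta * C <= y) -> x <= y.
Proof.
  intros HC H; apply Rnot_lt_le; intros Hlt.
  specialize (H ((x - y) / (2 * (C + 1))) ltac:(apply Rdiv_lt_0_compat; lra)).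
  assert (E : (x - y) / (2 * (C + 1)) * C <= (x - y) / 2).
  { apply Rmult_le_reg_r with (2 * (C + 1)); [lra|].
    field_simplify; [nra|lra]. }
  lra.
Qed.

(** * Bounds on the solution, by compactness and by barriers *)

Lemma solution_lower_bound (p : R) (phi : R -> R) (u ut ux uxx : R -> R -> R)
  (a b c d : R) :
  global_solution p phi u ut ux uxx -> 0 <= a <= b -> 0 < c <= d ->
  (forall x t, a <= x <= b -> c <= t <= d -> 0 < u x t) ->
  exists m, 0 < m /\ forall x t, a <= x <= b -> c <= t <= d -> m <= u x t.
Proof.
  intros Hsol Hab Hcd Hu.
  destruct (rectangle_min u a b c d) as [x [t [[Hx Ht] Hmin]]]; [lra|lra| |].
  - generalize (C21_cont _ _ _ _ (sol_C21 _ _ _ _ _ _ Hsol)).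
    apply continuous_on_prod_subset; unfold Omega_bar; intros; lra.
  - exists (u x t); auto.
Qed.

Lemma solution_upper_bound (p : R) (phi : R -> R) (u ut ux uxx : R -> R -> R)
  (a b c d : R) :
  global_solution p phi u ut ux uxx -> 0 <= a <= b -> 0 < c <= d ->
  exists M, 0 <= M /\ forall x t, a <= x <= b -> c <= t <= d -> u x t <= M.
Proof.
  intros Hsol Hab Hcd.
  destruct (rectangle_min (fun x t => 0 - u x t) a b c d) as [x [t [[Hx Ht] Hmin]]]; [lra|lra| |].
  - apply continuous_on_prod_minus.
    + apply continuous_on_prod_everywhere; intros; apply continuous_const.
    + generalize (C21_cont _ _ _ _ (sol_C21 _ _ _ _ _ _ Hsol)).
      apply continuous_on_prod_subset; unfold Omega_bar; intros; lra.
  - exists (Rmax 0 (u x t)); split; [apply Rmax_l|].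
    intros y s Hy Hs; specialize (Hmin y s Hy Hs).
    assert (A := Rmax_r 0 (u x t)); lra.
Qed.

(* Hopf's lemma in a weak form: the barrier below is increasing in [x], hence a
   subsolution for the Neumann condition, and [1 + be / 2 > 1] makes it negative
   near [x = 0] at time 4, where [u] has no positive lower bound yet. *)
Lemma boundary_positive (p : R) (phi : R -> R) (u ut ux uxx : R -> R -> R) :
  1 < p -> global_solution p phi u ut ux uxx -> positive_solution u -> 0 < u 0 5.
Proof.
  intros Hp Hsol Hpos.
  destruct (solution_upper_bound _ _ _ _ _ _ 0 1 4 5 Hsol) as [M [HM0 HM]]; [lra|lra|].
  (* Makes [be - u >= 1], so that diffusion outweighs both the drift and the time derivative of the
     barrier. *)
  set (be := M + 1).
  assert (Hbe : 1 <= be) by (unfold be; lra).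
  (* The root of [exp (be * x) = 1 + be / 2]: up to it the barrier is nonpositive at time 4, and
     beyond it [u >= m] takes over. *)
  set (del := ln (1 + be / 2) / be).
  assert (Hdel : 0 < del < 1).
  { unfold del; split.
    - apply Rdiv_lt_0_compat; [rewrite <- ln_1; apply ln_increasing; lra|lra].
    - apply Rmult_lt_reg_r with be; [lra|].
      unfold Rdiv; rewrite Rmult_assoc, Rinv_l, Rmult_1_r, Rmult_1_l by lra.
      rewrite <- (ln_exp be) at 2; apply ln_increasing; [lra|].
      assert (A := exp_ineq1_le be); lra. }
  destruct (solution_lower_bound _ _ _ _ _ _ del 1 4 5 Hsol) as [m [Hm0 Hm]]; [lra|lra| |].
  { intros x t Hx Ht; apply Hpos; unfold Omega; lra. }
  (* The bracket in [s] is at most [exp be + be] on the rectangle, so this scale keeps [s <= m]. *)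
  set (ep := m / (exp be + be)).
  assert (Hden : 0 < exp be + be) by (assert (A := exp_pos be); lra).
  assert (Hep : 0 < ep) by (apply Rdiv_lt_0_compat; lra).
  assert (Hepm : ep * (exp be + be) = m) by (unfold ep; field; lra).
  set (s := fun x t => ep * (exp (be * x) - (1 + be / 2) + be * (t - 4))).
  assert (Hs : forall x t, 0 <= x <= 1 -> 4 <= t <= 5 -> s x t <= m).
  { intros x t Hx Ht; rewrite <- Hepm; unfold s; apply Rmult_le_compat_l; [lra|].
    assert (exp (be * x) <= exp be) by (apply exp_monotone; nra); nra. }
  (* At this corner the barrier equals [ep * be / 2]. The comparison is made with tolerance 0. *)
  enough (s 0 5 - 0 * exp ((p * Rpower m (p - 1) + 1) * (5 - 4)) <= u 0 5).
  { assert (0 < s 0 5); [|lra].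
    unfold s; rewrite Rmult_0_r, exp_0; apply Rmult_lt_0_compat; lra. }
  apply (comparison p phi u ut ux uxx s
    (fun _ _ => ep * be) (fun x _ => ep * (be * exp (be * x)))
    (fun x _ => ep * (be * be * exp (be * x))) 0 1 4 5 0 m); auto; try lra.
  - intros x t _ _; unfold s; auto_derive; [exact I|ring].
  - intros x t _ _; unfold s; auto_derive; [exact I|ring].
  - intros x t _ _; auto_derive; [exact I|ring].
  - apply continuous_on_prod_everywhere; intros x t _ _; unfold s.
    apply (continuous_mult (K := R_AbsRing)); [apply continuous_const|].
    apply (continuous_plus (V := R_NormedModule)).
    + apply (continuous_comp (fun z : R * R => fst z) (fun x => exp (be * x) - (1 + be / 2)));
        [apply continuous_fst|].
      apply (ex_derive_continuous (V := R_NormedModule)); auto_derive; exact I.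
    + apply (continuous_snd_comp (fun t => be * (t - 4))).
      apply (ex_derive_continuous (V := R_NormedModule)); auto_derive; exact I.
  - intros x t Hx Ht.
    assert (A := pow_nonneg_ge0 (s x t) p).
    assert (E : 1 <= exp (be * x)) by (rewrite <- exp_0; apply exp_monotone; nra).
    specialize (HM x t Hx Ht).
    enough (ep * be * 1 <= ep * be * (exp (be * x) * (be - u x t))) by lra.
    apply Rmult_le_compat_l; [nra|].
    assert (1 <= be - u x t) by (unfold be; lra); nra.
  - intros x Hx; rewrite Rminus_0_r.
    destruct (Rle_lt_dec x del) as [H|H].
    + apply Rle_trans with 0.
      * unfold s.
        assert (exp (be * x) <= 1 + be / 2); [|nra].
        rewrite <- (exp_ln (1 + be / 2)) by lra; apply exp_monotone.
        apply Rle_trans with (be * del); [apply Rmult_le_compat_l; lra|].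
        right; unfold del; field; lra.
      * apply (positive_solution_nonneg _ _ _ _ _ _ Hsol Hpos); lra.
    + apply Rle_trans with m; [apply Hs|apply Hm]; lra.
  - intros t Ht; rewrite Rminus_0_r; apply Rle_trans with m; [apply Hs|apply Hm]; lra.
  - intros t Ht; right; split; [reflexivity|].
    apply Rmult_le_pos; [lra|]; apply Rmult_le_pos; [lra|left; apply exp_pos].
Qed.

(* [exp (- x^2 / (t - 1))] is a subsolution of the heat equation where
   [2 (t - 1) <= 3 x^2], and it vanishes as [t] decreases to 1. *)
Lemma gaussian_lower_bound (p : R) (phi : R -> R) (u ut ux uxx : R -> R -> R) :
  1 < p -> global_solution p phi u ut ux uxx -> positive_solution u ->
  exists ep, 0 < ep /\ forall x, 0 <= x -> ep * exp (- x ^ 2 / 4) <= u x 5.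
Proof.
  intros Hp Hsol Hpos.
  (* The left edge is 2 because [2 (t - 1) <= 8 <= 12 <= 3 x^2] for [t <= 5] and [x >= 2]; the
     segment [[0, 2]] is treated by compactness at time 5. *)
  destruct (solution_lower_bound _ _ _ _ _ _ 2 2 1 5 Hsol) as [m1 [Hm1 H1]]; [lra|lra| |].
  { intros x t Hx Ht; apply Hpos; unfold Omega; lra. }
  destruct (solution_lower_bound _ _ _ _ _ _ 0 2 5 5 Hsol) as [m2 [Hm2 H2]]; [lra|lra| |].
  { intros x t Hx Ht; replace t with 5 by lra.
    destruct (Rle_lt_or_eq_dec 0 x (proj1 Hx)) as [H| <-].
    - apply Hpos; unfold Omega; lra.
    - apply (boundary_positive _ _ _ _ _ _ Hp Hsol Hpos). }
  set (ep := Rmin m1 m2).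
  assert (Hep : 0 < ep) by (apply Rmin_glb_lt; assumption).
  assert (Hep1 : ep <= m1) by apply Rmin_l.
  assert (Hep2 : ep <= m2) by apply Rmin_r.
  assert (Hdamp : forall w, w <= 0 -> ep * exp w <= ep).
  { intros w Hw; rewrite <- (Rmult_1_r ep) at 2; apply Rmult_le_compat_l; [lra|].
    rewrite <- exp_0; apply exp_monotone, Hw. }
  exists ep; split; [exact Hep|].
  intros x Hx.
  destruct (Rle_lt_dec x 2) as [Hx2|Hx2].
  { apply Rle_trans with ep; [apply Hdamp; nra|].
    specialize (H2 x 5); lra. }
  set (k := p * Rpower ep (p - 1) + 1).
  apply (le_of_forall_eps _ _ (exp (k * 4))); [left; apply exp_pos|].
  intros eta Heta.
  (* The rate [1 / 4] is a lower bound for [1 / (t - 1)] up to time 5. *)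
  destruct (gaussian_tail (1 / 4) ep eta x) as [X [HxX HX]]; [lra|exact Heta|].
  destruct (solution_lower_bound _ _ _ _ _ _ 2 X 1 5 Hsol) as [m [Hm Hmu]]; [lra|lra| |].
  { intros y t Hy Ht; apply Hpos; unfold Omega; lra. }
  (* For [y >= 2] the initial exponent [- Y^2 y^2] is at most [- 4 Y^2], so the Gaussian starts
     below [m]. *)
  destruct (gaussian_tail 4 ep m 1) as [Y [HY1 HY]]; [lra|exact Hm|].
  (* the starting time [t0] satisfies [1 / (t0 - 1) = Y ^ 2] *)
  set (t0 := 1 + / Y ^ 2).
  assert (HY2 : 1 <= Y ^ 2) by nra.
  assert (Ht0 : 1 < t0 <= 2).
  { unfold t0; split; [assert (A := Rinv_0_lt_compat (Y ^ 2)); lra|].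
    assert (A := Rinv_le_contravar 1 (Y ^ 2) Rlt_0_1 HY2); rewrite Rinv_1 in A; lra. }
  assert (Hquarter : forall t, t0 <= t <= 5 -> / 4 <= / (t - 1)).
  { intros t Ht; apply Rinv_le_contravar; lra. }
  assert (Hexp : forall w, exp (ln ep - w) = ep * exp (- w)).
  { intros w; unfold Rminus; rewrite exp_plus, exp_ln by exact Hep; reflexivity. }
  assert (Hmain : exp (ln ep - / (5 - 1) * x ^ 2)
      - eta * exp (k * (5 - t0)) <= u x 5).
  { apply (gaussian_comparison p phi u ut ux uxx (fun _ => ln ep) (fun _ => 0)
      (fun t => / (t - 1)) (fun t => - / (t - 1) ^ 2) 2 X t0 5 eta ep); auto; try lra.
    - intros t Ht; apply (is_derive_const (ln ep)).
    - intros t Ht; auto_derive; [lra|field; lra].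
    - intros t Ht; specialize (Hquarter t Ht); lra.
    - intros t Ht; rewrite exp_ln; lra.
    - intros y t Hy Ht.
      assert (A := exp_pos ((p - 1) * (ln ep - / (t - 1) * y ^ 2))).
      enough (0 <= / (t - 1) * (3 * y ^ 2 * / (t - 1) - 2)).
      { rewrite !pow_inv; replace (0 - - / (t - 1) ^ 2 * y ^ 2)
          with (/ (t - 1) ^ 2 * y ^ 2) by ring.
        replace (/ (t - 1) ^ 2) with (/ (t - 1) * / (t - 1)) by (field; lra).
        nra. }
      specialize (Hquarter t Ht).
      apply Rmult_le_pos; [lra|]; nra.
    - intros y Hy; rewrite Hexp.
      apply Rle_trans with m; [|apply Hmu; lra].
      enough (ep * exp (- (/ (t0 - 1) * y ^ 2)) <= ep * exp (- (4) * Y ^ 2)) by lra.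
      apply Rmult_le_compat_l; [lra|]; apply exp_monotone.
      replace (/ (t0 - 1)) with (Y ^ 2) by (unfold t0; field; nra).
      assert (4 <= y ^ 2) by nra; nra.
    - intros t Ht; rewrite Hexp.
      apply Rle_trans with 0; [|left; apply Hpos; unfold Omega; lra].
      enough (ep * exp (- (/ (t - 1) * X ^ 2)) <= ep * exp (- (1 / 4) * X ^ 2)) by lra.
      apply Rmult_le_compat_l; [lra|]; apply exp_monotone.
      specialize (Hquarter t Ht); assert (0 <= X ^ 2) by apply pow2_ge_0; nra.
    - intros t Ht; left; rewrite Hexp.
      specialize (Hquarter t Ht).
      assert (ep * exp (- (/ (t - 1) * 2 ^ 2)) <= ep) by (apply Hdamp; nra).
      specialize (H1 2 t ltac:(lra) ltac:(lra)); lra. }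
  apply Rle_trans with (2 := Hmain).
  assert (Hk : 0 < k) by (unfold k; assert (A := exp_pos ((p - 1) * ln ep)); unfold Rpower; nra).
  assert (E : exp (k * (5 - t0)) <= exp (k * 4)) by (apply exp_monotone; nra).
  rewrite Hexp.
  replace (- (/ (5 - 1) * x ^ 2)) with (- x ^ 2 / 4) by field.
  nra.
Qed.

(** * The blow-up profile *)

(* Only the tangent-line bound [exp (1 - w) >= 2 - w] and [t ^ (- q / 2) >= 1 / t]
   are used on the reaction term; the coefficient of [x ^ 2] that remains is
   [K ^ 2 + K (2 - q) / (4 t)], and this is where [q = p - 1 <= 2] enters. *)
Lemma blowup_profile_subsolution (q t E K x : R) :
  0 < q <= 2 -> 1 <= t -> 0 < E -> K = / (exp 1 * t * E) ->
  (- / (2 * t) + K) - (- / (4 * t ^ 2) + (q * K ^ 2 - K / t) / 2) * x ^ 2 <=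
  4 * (/ (4 * t) + K / 2) ^ 2 * x ^ 2 - 2 * (/ (4 * t) + K / 2)
  + exp (q * (- ln t / 2 - ln E / q - (/ (4 * t) + K / 2) * x ^ 2)).
Proof.
  intros Hq Ht HE HK.
  assert (He := exp_pos 1).
  assert (HK0 : 0 < K).
  { rewrite HK; apply Rinv_0_lt_compat; repeat apply Rmult_lt_0_compat; lra. }
  set (B := / (4 * t) + K / 2).
  set (w := q * B * x ^ 2).
  assert (Hreact : K * (2 - w) <= exp (q * (- ln t / 2 - ln E / q - B * x ^ 2))).
  { apply Rle_trans with (K * exp (1 - w)).
    - apply Rmult_le_compat_l; [lra|].
      assert (A := exp_ineq1_le (1 - w)); lra.
    (* By the choice of [K], the product [K * exp (1 - w)] is [exp (- w) / (t E)]. *)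
    - replace (K * exp (1 - w)) with (exp (- ln t - ln E - w)).
      + apply exp_monotone.
        replace (q * (- ln t / 2 - ln E / q - B * x ^ 2))
          with (- (q / 2 * ln t) - ln E - w) by (unfold w; field; lra).
        assert (0 <= ln t) by (rewrite <- ln_1; apply ln_le; lra); nra.
      + replace (- ln t - ln E - w) with (- ln t + (- ln E + (- (1) + (1 - w)))) by ring.
        rewrite !exp_plus, !exp_Ropp, !exp_ln, HK by lra; field; lra. }
  set (r := / t) in *.
  assert (Hr : 0 < r) by (apply Rinv_0_lt_compat; lra).
  assert (HB : B = r / 4 + K / 2) by (unfold B, r; field; lra).
  replace (/ (2 * t)) with (r / 2) by (unfold r; field; lra).
  replace (/ (4 * t ^ 2)) with (r ^ 2 / 4) by (unfold r; field; lra).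
  replace (K / t) with (K * r) by (unfold r; field; lra).
  assert (Hcoef : 0 <= (K ^ 2 + K * r * (2 - q) / 4) * x ^ 2).
  { apply Rmult_le_pos; [|apply pow2_ge_0].
    assert (0 <= K * r * (2 - q)) by (repeat apply Rmult_le_pos; lra); nra. }
  (* The terms free of [x] are [- r / 2 + K] on both sides and cancel; the surplus in [x^2] is
     [Hcoef]. *)
  unfold w in Hreact; rewrite HB in *; nra.
Qed.

(** * Finite-time blow-up against boundedness on compact sets *)

Theorem theorem3p10 (p : R) (phi : R -> R)
  (hp : 1 < p <= 3)
  (hphi_cont : continuous_on Omega_bar phi)
  (hphi_nonneg : forall x : R, Omega_bar x -> 0 <= phi x) :
  ~ exists u ut ux uxx : R -> R -> R,
      global_solution p phi u ut ux uxx /\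
      positive_solution u /\
      growth_condition u ux.
Proof.
  intros [u [ut [ux [uxx [Hsol [Hpos _]]]]]].
  destruct (gaussian_lower_bound _ _ _ _ _ _ (proj1 hp) Hsol Hpos) as [ep [Hep Hlow]].
  set (q := p - 1).
  assert (Hq : 0 < q <= 2) by (unfold q; lra).
  assert (He := exp_pos 1).
  (* Makes the initial amplitude [al^(-1/q)] equal to [ep]. *)
  set (al := exp (- q * ln ep)).
  assert (Hal : 0 < al) by apply exp_pos.
  (* The value of [ln (t - 4)] at which [E] vanishes. *)
  set (L := exp 1 * al / q).
  assert (HL : 0 < L) by (apply Rdiv_lt_0_compat; nra).
  (* the amplitude blows up at time [4 + T] *)
  set (T := exp L).
  (* The shift by 4 puts the profile at its own time 1 when [t = 5], where the Gaussian lower bound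
     holds. *)
  set (E := fun t => al - q / exp 1 * ln (t - 4)).
  destruct (solution_upper_bound _ _ _ _ _ _ 0 0 5 (4 + T) Hsol) as [M [HM0 HM]]; [lra| |].
  { assert (A := exp_ineq1_le L); unfold T; lra. }
  (* With this [C], [E t1 <= exp (- C)] forces [g t1 >= ln (M + 1)]; the term [L / 2] pays for the
     factor [(t - 4)^(-1/2)]. *)
  set (C := q * (ln (M + 1) + L / 2)).
  (* The gap between [ln (t1 - 4)] and [L]: the first bound keeps [t1 >= 5], the second makes
     [E t1 <= exp (- C)]. *)
  set (s := Rmin L (exp 1 / q * exp (- C))).
  assert (Hs : 0 < s).
  { apply Rmin_glb_lt; [exact HL|].
    apply Rmult_lt_0_compat; [apply Rdiv_lt_0_compat; lra|apply exp_pos]. }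
  assert (HsL : s <= L) by apply Rmin_l.
  assert (HsC : s <= exp 1 / q * exp (- C)) by apply Rmin_r.
  set (t1 := 4 + exp (L - s)).
  assert (Ht1 : 5 <= t1 <= 4 + T).
  { unfold t1, T; split.
    - assert (A := exp_ineq1_le (L - s)); lra.
    - apply Rplus_le_compat_l, exp_monotone; lra. }
  assert (HEt1 : E t1 = q / exp 1 * s).
  { unfold E, t1; replace (4 + exp (L - s) - 4) with (exp (L - s)) by ring.
    rewrite ln_exp; unfold L; field; lra. }
  assert (HE1 : 0 < E t1).
  { rewrite HEt1; apply Rmult_lt_0_compat; [apply Rdiv_lt_0_compat; lra|exact Hs]. }
  assert (Hln0 : forall t, 5 <= t -> 0 <= ln (t - 4)).
  { intros t Ht; rewrite <- ln_1; apply ln_le; lra. }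
  assert (HE : forall t, 5 <= t <= t1 -> E t1 <= E t).
  { intros t Ht; unfold E.
    assert (ln (t - 4) <= ln (t1 - 4)) by (apply ln_le; lra).
    assert (0 < q / exp 1) by (apply Rdiv_lt_0_compat; lra); nra. }
  set (K := fun t => / (exp 1 * (t - 4) * E t)).
  assert (HEe : forall t, 5 <= t <= t1 -> 0 < al * exp 1 - q * ln (t - 4)).
  { intros t Ht; specialize (HE t Ht).
    replace (al * exp 1 - q * ln (t - 4)) with (exp 1 * E t) by (unfold E; field; lra).
    apply Rmult_lt_0_compat; lra. }
  assert (HK : forall t, 5 <= t <= t1 -> 0 < K t).
  { intros t Ht; specialize (HE t Ht).
    apply Rinv_0_lt_compat; repeat apply Rmult_lt_0_compat; lra. }
  set (g := fun t => - ln (t - 4) / 2 - ln (E t) / q).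
  set (B := fun t => / (4 * (t - 4)) + K t / 2).
  (* This is [(E t1)^(-1/q)], a bound for the amplitude because [E >= E t1] and
     [(t - 4)^(-1/2) <= 1]. *)
  set (Z := exp (g 5 - ln (E t1) / q + ln (E 5) / q)).
  assert (HZ : forall t, 5 <= t <= t1 -> exp (g t) <= Z).
  { intros t Ht; apply exp_monotone; unfold g.
    replace (5 - 4) with 1 by ring; rewrite ln_1.
    assert (A1 : ln (E t1) <= ln (E t)) by (apply ln_le; auto).
    assert (A2 := Hln0 t (proj1 Ht)).
    assert (A3 : ln (E t1) / q <= ln (E t) / q).
    { apply Rmult_le_compat_r; [left; apply Rinv_0_lt_compat; lra|exact A1]. }
    lra. }
  set (k := p * Rpower Z (p - 1) + 1).
  assert (Hblow : exp (g t1 - B t1 * 0 ^ 2) <= u 0 t1).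
  { apply (le_of_forall_eps _ _ (exp (k * (t1 - 5)))); [left; apply exp_pos|].
    intros eta Heta.
    assert (HT := exp_pos L : 0 < T).
    (* The tail rate is uniform: [B t >= 1 / (4 (t - 4)) >= 1 / (4 T)] up to [t1]. *)
    destruct (gaussian_tail (/ (4 * T)) Z eta 0) as [X [HX0 HX]];
      [apply Rinv_0_lt_compat; lra|exact Heta|].
    apply (gaussian_comparison p phi u ut ux uxx g
      (fun t => - / (2 * (t - 4)) + K t) B
      (fun t => - / (4 * (t - 4) ^ 2) + (q * K t ^ 2 - K t / (t - 4)) / 2)
      0 X 5 t1 eta Z); auto; try lra.
    - intros t Ht; specialize (HE t Ht); specialize (HEe t Ht); unfold g, K, E in *.
      auto_derive; change (t + - (4)) with (t - 4); [repeat split; lra|].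
      field; repeat split; lra.
    (* Since [E' = - q / (e (t - 4))], one has [K' = q K^2 - K / (t - 4)]. *)
    - intros t Ht; specialize (HE t Ht); specialize (HEe t Ht); unfold B, K, E in *.
      assert (A : exp 1 * (t - 4) * (al - q / exp 1 * ln (t - 4)) <> 0).
      { apply Rgt_not_eq; repeat apply Rmult_lt_0_compat; lra. }
      auto_derive; change (t + - (4)) with (t - 4); [repeat split; try lra; exact A|].
      field; repeat split; try lra.
    - intros t Ht; specialize (HK t Ht); unfold B.
      assert (0 < / (4 * (t - 4))) by (apply Rinv_0_lt_compat; lra); lra.
    - intros x t Hx Ht; fold q; unfold g, B.
      specialize (HE t Ht).
      apply blowup_profile_subsolution; [exact Hq|lra|lra|reflexivity].
    (* At time 5, [g = ln ep] and [B > 1 / 4], so the profile lies under the Gaussian lower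
       bound. *)
    - intros x Hx; apply Rle_trans with (2 := Hlow x (proj1 Hx)).
      specialize (HK 5 ltac:(lra)).
      rewrite <- (exp_ln ep) at 1 by exact Hep; rewrite <- exp_plus.
      apply Rle_trans with (exp (g 5 - B 5 * x ^ 2)); [lra|].
      apply exp_monotone.
      replace (g 5) with (ln ep).
      + unfold B; replace (4 * (5 - 4)) with 4 by ring.
        assert (0 <= x ^ 2) by apply pow2_ge_0; nra.
      + unfold g, E; replace (5 - 4) with 1 by ring; rewrite ln_1, Rmult_0_r, Rminus_0_r.
        unfold al; rewrite ln_exp; field; lra.
    - intros t Ht.
      apply Rle_trans with 0.
      2:{ apply (positive_solution_nonneg _ _ _ _ _ _ Hsol Hpos); lra. }
      enough (exp (g t - B t * X ^ 2) <= Z * exp (- / (4 * T) * X ^ 2)) by lra.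
      unfold Rminus; rewrite exp_plus.
      apply Rmult_le_compat; try (left; apply exp_pos); [auto|].
      apply exp_monotone.
      assert (A : / (4 * T) <= / (4 * (t - 4))) by (apply Rinv_le_contravar; lra).
      specialize (HK t Ht); unfold B; assert (0 <= X ^ 2) by apply pow2_ge_0; nra. }
  assert (Hlarge : M + 1 <= exp (g t1 - B t1 * 0 ^ 2)).
  { rewrite <- (exp_ln (M + 1)) by lra; apply exp_monotone.
    unfold g; rewrite HEt1; unfold t1 at 1.
    replace (4 + exp (L - s) - 4) with (exp (L - s)) by ring; rewrite ln_exp.
    assert (A : ln (q / exp 1 * s) <= - C).
    { rewrite <- (ln_exp (- C)); apply ln_le; [rewrite <- HEt1; exact HE1|].
      replace (exp (- C)) with (q / exp 1 * (exp 1 / q * exp (- C))) by (field; lra).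
      apply Rmult_le_compat_l; [left; apply Rdiv_lt_0_compat; lra|exact HsC]. }
    assert (A' : ln (q / exp 1 * s) / q <= - C / q).
    { apply Rmult_le_compat_r; [left; apply Rinv_0_lt_compat; lra|exact A]. }
    replace (- C / q) with (- (ln (M + 1) + L / 2)) in A' by (unfold C; field; lra).
    lra. }
  specialize (HM 0 t1 ltac:(lra) ltac:(lra)); lra.
Qed.
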